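(* Let $(X,d)$ be a complete metric space and let $S,T:X\to CB(X)$ be a duality of generalized $\varphi$-weak contractions, i.e. $\varphi:[0,+\infty)\to[0,+\infty)$ satisfies $\varphi(0)=0$, $\varphi(t)<t$ for all $t>0$, and $H(Sx,Ty)\le\varphi(M(x,y))$ for all $x,y\in X$. Suppose that $\varphi$ is upper semicontinuous and $$\limsup_{t\to 0}\frac{\varphi(t)}{t}<1 .$$ Then $Fix(S)=Fix(T)\neq\emptyset$.
   Context: $X$ is nonempty. $CB(X)$ is the class of nonempty closed and bounded subsets of the metric space $(X,d)$. For $x\in X$ and $A\subseteq X$, $d(x,A)=\inf_{a\in A}d(x,a)$. $H$ is the Hausdorff metric on $CB(X)$: $H(A,B)=\max\{\sup_{x\in B}d(x,A),\ \sup_{x\in A}d(x,B)\}$. For $S,T:X\to CB(X)$, put $$M(x,y)=\max\Big\{d(x,y),\ d(x,Sx),\ d(y,Ty),\ \tfrac{d(x,Ty)+d(y,Sx)}{2}\Big\}.$$ $Fix(T)=\{x\in X: x\in Tx\}$. The limsup as $t\to0$ is over $t>0$. *)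

(* Defs.v *)
From HB Require Import structures.
From mathcomp Require Import all_boot all_order all_algebra.
From mathcomp Require Import all_classical all_reals all_analysis.

Set Implicit Arguments.
Unset Strict Implicit.
Unset Printing Implicit Defensive.

Import Order.TTheory GRing.Theory Num.Theory.
Import numFieldNormedType.Exports.

Local Open Scope classical_set_scope.
Local Open Scope ring_scope.

(* [Complete] includes a base point, so these spaces are nonempty. *)
#[short(type="completeMetricType")]
HB.structure Definition CompleteMetric (R : numDomainType) :=
  {T of CompletePseudoMetric R T & Metric R T}.

Section set_valued_maps.
Context {R : realType} {X : metricType R}.
Implicit Types (x y : X) (A B : set X) (S T : X -> set X) (phi : R -> R).

(* The library's [bounded_set] is about norms. *)
Definition metric_bounded A : Prop :=
  exists C : R, forall x y, A x -> A y -> mdist x y <= C.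

Definition CB : set (set X) :=
  [set A | [/\ A !=set0, closed A & metric_bounded A]].

(* [inf] and [sup] are the real-valued ones, with default value 0 when the set
   is empty or unbounded; this never happens below for A and B in [CB]. *)
Definition dist_set x A : R := inf [set mdist x a | a in A].

Definition hausdorff_dist A B : R :=
  Num.max (sup [set dist_set x A | x in B]) (sup [set dist_set x B | x in A]).

Definition Mmax S T x y : R :=
  Num.max (Num.max (mdist x y) (dist_set x (S x)))
    (Num.max (dist_set y (T y)) ((dist_set x (T y) + dist_set y (S x)) / 2)).

Definition Fix T : set X := [set x | T x x].

(* A function [0, +oo) -> [0, +oo) is a map R -> R of which only the values on
   [0, +oo) are constrained. *)
Definition duality_phi_weak_contractions phi S T : Prop :=
  [/\ (forall x, CB (S x)) /\ (forall x, CB (T x)),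
      forall t, 0 <= t -> 0 <= phi t,
      phi 0 = 0,
      forall t, 0 < t -> phi t < t &
      forall x y, hausdorff_dist (S x) (T y) <= phi (Mmax S T x y)].

End set_valued_maps.

(* Upper semicontinuity of the restriction of f to D, for the topology induced
   on D. *)
Definition upper_semicontinuous_on {X : topologicalType} {R : realType}
    (D : set X) (f : X -> R) : Prop :=
  forall x, D x -> forall a, f x < a -> \forall y \near within D (nbhs x), f y < a.

(* Main.v *)
Require Import Defs.
From mathcomp Require Import all_boot all_order all_algebra.
From mathcomp Require Import all_classical all_reals all_analysis.
From mathcomp Require Import lra.

Import Order.TTheory GRing.Theory Num.Theory.
Import numFieldNormedType.Exports.

Local Open Scope classical_set_scope.
Local Open Scope ring_scope.

(* Build an orbit that follows S and T alternately. If y is in S x then M(x, y)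
   is the maximum of d(x, y) and d(y, T y), and phi t < t excludes the second
   one, so that d(y, T y) <= phi (d(x, y)); the next point can thus be chosen
   with d_(n+1) <= (phi d_n + d_n) / 2. Choosing this average, rather than
   phi d_n plus an error term, keeps the step lengths decreasing, lets upper
   semicontinuity force them to 0, and turns phi t <= c t near 0 into a
   geometric decay of ratio (1 + c) / 2. So the orbit converges, to x say; as
   M(x_2n, x) tends to D = d(x, T x) from above, upper semicontinuity gives
   D <= phi D, whence D = 0. *)

(** * Distance from a point to a set, and its bound by the Hausdorff distance *)

Lemma dist_set_has_inf {R : realType} {X : metricType R} (x : X) (A : set X) :
  A !=set0 -> has_inf [set mdist x a | a in A].
Proof.
move=> [a Aa]; split; first by exists (mdist x a), a.
by exists 0 => _ [b _ <-]; exact: mdist_ge0.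
Qed.

Lemma dist_set_ge0 {R : realType} {X : metricType R} (x : X) (A : set X) :
  A !=set0 -> 0 <= dist_set x A.
Proof.
move=> A0; apply: lb_le_inf; first by case: (dist_set_has_inf x A A0).
by move=> _ [b _ <-]; exact: mdist_ge0.
Qed.

Lemma dist_set_le {R : realType} {X : metricType R} (x a : X) (A : set X) :
  A a -> dist_set x A <= mdist x a.
Proof.
move=> Aa; apply: ge_inf; last by exists a.
by have [] := dist_set_has_inf x A (ex_intro _ a Aa).
Qed.

Lemma dist_set_lt {R : realType} {X : metricType R} (x : X) (A : set X) (e : R) :
  A !=set0 -> dist_set x A < e -> exists2 a, A a & mdist x a < e.
Proof.
move=> A0; rewrite -subr_gt0 => h.
have [_ [a Aa <-]] := inf_adherent h (dist_set_has_inf x A A0).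
by rewrite -/(dist_set x A) addrC subrK; exists a.
Qed.

Lemma dist_set_lip {R : realType} {X : metricType R} (x y : X) (A : set X) :
  A !=set0 -> dist_set x A <= mdist x y + dist_set y A.
Proof.
move=> A0; apply/ler_addgt0Pr => e e0.
have [a Aa yae] : exists2 a, A a & mdist y a < dist_set y A + e.
  by apply: dist_set_lt => //; rewrite ltrDl.
have := dist_set_le x a A Aa; have := metric_triangle x y a; lra.
Qed.

Lemma closed_dist_set0 {R : realType} {X : metricType R} (x : X) (A : set X) :
  A !=set0 -> closed A -> dist_set x A <= 0 -> A x.
Proof.
move=> A0 clA xA; apply: clA => B /nbhs_ballP[/= e e0 eB].
have [a Aa xae] : exists2 a, A a & mdist x a < e.
  by apply: dist_set_lt => //; exact: le_lt_trans e0.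
by exists a; split => //; apply: eB; rewrite ballEmdist.
Qed.

Lemma dist_set_hausdorff {R : realType} {X : metricType R} (x : X) (A B : set X) :
  CB A -> CB B -> A x -> dist_set x B <= hausdorff_dist A B.
Proof.
move=> [_ _ [C bC]] [[b Bb] _ _] Ax; rewrite /hausdorff_dist le_max.
apply/orP; right; apply: ub_le_sup; last by exists x.
(* A real [sup] dominates its elements only when the set is bounded above; boundedness of [A]
   provides this, measuring through one point [b] of [B]. *)
exists (C + mdist x b) => _ [z Az <-].
have := dist_set_le z b B Bb; have := metric_triangle z x b.
have := bC z x Az Ax; lra.
Qed.

(** * Consequences of the contraction condition *)

Lemma duality_sym {R : realType} {X : metricType R} (S T : X -> set X)
    (phi : R -> R) :
  duality_phi_weak_contractions phi S T -> duality_phi_weak_contractions phi T S.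
Proof.
move=> [[CS CT] phi0 phi00 philt HST]; split => // x y.
have -> : Mmax T S x y = Mmax S T y x.
  by rewrite /Mmax metric_sym [dist_set x (S y) + _]addrC maxACA.
by rewrite /hausdorff_dist maxC; exact: HST.
Qed.

(** At a fixed point of [S], M(x, x) collapses to D = d(x, T x), so D > 0 would give D <= phi D <
    D. *)
Lemma duality_fix {R : realType} {X : metricType R} (S T : X -> set X)
    (phi : R -> R) (x : X) :
  duality_phi_weak_contractions phi S T -> S x x -> T x x.
Proof.
move=> [[CS CT] _ _ philt HST] Sxx.
have [T0 clT _] := CT x; have [S0 _ _] := CS x.
have dS : dist_set x (S x) = 0.
  apply/le_anti; rewrite dist_set_ge0// andbT.
  by rewrite -(mdistxx x) dist_set_le.
have D0 := dist_set_ge0 x (T x) T0.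
apply: closed_dist_set0 => //; rewrite leNgt; apply/negP => Dgt.
have := dist_set_hausdorff x _ _ (CS x) (CT x) Sxx.
have := HST x x; have := philt _ Dgt.
have -> : Mmax S T x x = dist_set x (T x).
  rewrite /Mmax mdistxx dS addr0 maxxx.
  rewrite [Num.max (dist_set _ _) _]max_l; last lra.
  by rewrite max_r.
lra.
Qed.

Lemma duality_dist_step {R : realType} {X : metricType R} (S T : X -> set X)
    (phi : R -> R) (x y : X) :
  duality_phi_weak_contractions phi S T -> S x y ->
  dist_set y (T y) <= phi (mdist x y).
Proof.
move=> [[CS CT] phi0 _ philt HST] Sxy.
have [T0 _ _] := CT y; have S0 : S x !=set0 by exists y.
have dS : dist_set y (S x) = 0.
  apply/le_anti; rewrite dist_set_ge0// andbT.
  by rewrite -(mdistxx y) dist_set_le.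
have D0 := dist_set_ge0 y (T y) T0.
have DH := dist_set_hausdorff y _ _ (CS x) (CT y) Sxy.
have := HST x y; rewrite /Mmax dS addr0.
have dx := dist_set_le x y _ Sxy.
(* The averaged term is now d(x, T y) / 2, at most the mean of d(x, y) and d(y, T y), so it never
   exceeds their maximum. *)
have lipx := dist_set_lip x y (T y) T0.
have xy0 := mdist_ge0 x y.
rewrite (max_l dx); have [le_d|lt_d] := leP (dist_set y (T y)) (mdist x y).
  rewrite max_l; first lra.
  by rewrite ge_max le_d /=; lra.
rewrite max_r; last by rewrite le_max (ltW lt_d).
rewrite max_l; last lra.
have := philt _ (le_lt_trans xy0 lt_d); lra.
Qed.

Lemma duality_step {R : realType} {X : metricType R} (S T : X -> set X)
    (phi : R -> R) (x y : X) :
  duality_phi_weak_contractions phi S T -> S x y ->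
  exists2 z, T y z & mdist y z <= (phi (mdist x y) + mdist x y) / 2.
Proof.
move=> dST Sxy; have := duality_dist_step S T phi x y dST Sxy.
case: dST => -[CS CT] phi0 phi00 philt HST.
have [T0 clT _] := CT y.
(* At distance 0 there is no strict room between phi and the average; then d(y, T y) <= 0 and [y]
   itself is the next point. *)
have [->|xy] := eqVneq x y.
  rewrite mdistxx phi00 => D0; exists y; last by rewrite mdistxx; lra.
  exact: closed_dist_set0.
move: xy; rewrite -mdist_gt0 => /[dup] xy0 /philt phixy Dle.
have [z Tyz yz] : exists2 z, T y z &
    mdist y z < (phi (mdist x y) + mdist x y) / 2.
  by apply: dist_set_lt => //; lra.
by exists z => //; exact: ltW.
Qed.

(** * Real analysis of [phi] and of the step lengths *)

Lemma usc_nneg {R : realType} (phi : R -> R) (t a : R) :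
  upper_semicontinuous_on [set t : R | 0 <= t] phi -> 0 <= t -> phi t < a ->
  exists2 e, 0 < e & forall s, 0 <= s -> t <= s < t + e -> phi s < a.
Proof.
move=> usc t0 /(usc t t0) /= /nbhs_ballP[e /= e0 he].
(* Only the right half of the neighbourhood is kept: step lengths approach their infimum, and M its
   limit, from above. *)
exists e => // s s0 /andP[ts ste]; apply: he => //=.
by rewrite /ball/= ler0_norm; lra.
Qed.

Lemma halfway_decay {R : realType} (phi : R -> R) (d : nat -> R) :
  phi 0 = 0 -> (forall t, 0 < t -> phi t < t) ->
  upper_semicontinuous_on [set t : R | 0 <= t] phi ->
  (forall n, 0 <= d n) -> (forall n, d n.+1 <= (phi (d n) + d n) / 2) ->
  forall e, 0 < e -> exists N, forall n, (N <= n)%N -> d n < e.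
Proof.
move=> phi00 philt usc d0 dS.
have dle n : d n.+1 <= d n.
  have := dS n; have := d0 n; rewrite le_eqVlt => /orP[/eqP <-|/philt].
    by rewrite phi00; lra.
  lra.
have dmono m n : (m <= n)%N -> d n <= d m.
  by move=> /subnK <-; elim: (n - m)%N => // k; apply: le_trans (dle _).
have hi : has_inf (range d).
  by split; [exists (d 0%N), 0%N | exists 0 => _ [n _ <-]].
have lei n : inf (range d) <= d n by apply: ge_inf; [case: hi | exists n].
suff i0 : inf (range d) <= 0.
  move=> e e0; have [_ [N _ <-]] := inf_adherent e0 hi => dN.
  by exists N => n /dmono; lra.
rewrite leNgt; apply/negP => /[dup] igt /philt phii.
set i := inf _ in igt phii lei.
have [e e0 he] := usc_nneg phi i ((phi i + i) / 2) usc (ltW igt) ltac:(lra).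
(* The second bound makes the next step less than ((phi i + i) / 2 + i + (i - phi i) / 2) / 2 = i,
   below the infimum. *)
have m0 : 0 < Num.min e ((i - phi i) / 2) by rewrite lt_min e0; lra.
have [_ [n _ <-]] := inf_adherent m0 hi; rewrite -/i -ltrBlDl lt_min => /andP[h1 h2].
have := he (d n) (d0 n); rewrite lei /= => /(_ ltac:(lra)).
have := dS n; have := lei n.+1; lra.
Qed.

Lemma limsup_ratio_lt1 {R : realType} (phi : R -> R) :
  (limf_esup (fun t : R => (phi t / t)%:E) 0^'+ < 1)%E ->
  exists2 c, 0 <= c < 1 &
    exists2 e, 0 < e & forall t, 0 < t -> t < e -> phi t <= c * t.
Proof.
move=> /ereal_inf_lt[_ [V /nbhs_ballP[e /= e0 eV] <-] Vlt].
have [c c1 Vc] : exists2 c : R, c < 1 & forall t, V t -> phi t / t <= c.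
  have ub t : V t -> ((phi t / t)%:E <= ereal_sup [set (phi t / t)%:E | t in V])%E.
    by move=> Vt; apply: ereal_sup_ubound; exists t.
  move: Vlt ub; case: (ereal_sup _) => [c| |] //.
    by rewrite lte_fin => c1 ub; exists c => // t /ub; rewrite lee_fin.
  (* A supremum [-oo] would leave no [t] in [V], so any constant below 1 serves. *)
  by move=> _ ub; exists 0 => // t /ub.
exists (Num.max c 0); first by rewrite le_max lexx orbT gt_max c1 ltr01.
exists e => // t t0 te; rewrite -ler_pdivrMr// le_max Vc//.
apply: eV => //=; rewrite /ball/= sub0r normrN gtr0_norm//.
Qed.

(** * Convergence of orbits, their limits and their construction *)

Lemma cvg_geometric_steps {R : realType} {X : completeMetricType R}
    (u : nat -> X) (c : R) (N : nat) :
  0 <= c < 1 ->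
  (forall n, (N <= n)%N ->
     mdist (u n.+1) (u n.+2) <= c * mdist (u n) (u n.+1)) ->
  (forall e, 0 < e ->
     exists K, forall n, (K <= n)%N -> mdist (u n) (u n.+1) < e) ->
  exists x : X, u @ \oo --> x.
Proof.
move=> /andP[c0 c1] hc small.
have c1' : 0 < 1 - c by rewrite subr_gt0.
(* The geometric series bound d_n / (1 - c), cleared of its denominator. Peeling off the first step
   closes the induction, as d_n (1 - c) + c d_n = d_n. *)
have tail k n : (N <= n)%N ->
    mdist (u n) (u (n + k)%N) * (1 - c) <= mdist (u n) (u n.+1).
  elim: k n => [|k IH] n Nn; first by rewrite addn0 mdistxx mul0r mdist_ge0.
  rewrite addnS -addSn.
  have /(ler_wpM2r (ltW c1')) := metric_triangle (u n) (u n.+1) (u (n.+1 + k)%N).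
  have := IH n.+1 (leqW Nn); have := hc n Nn; lra.
suff /cauchy_cvg h : cauchy (u @ \oo) by exists (lim (u @ \oo)).
apply: cauchy_exP => e e0.
have [K hK] := small _ (mulr_gt0 e0 c1').
exists (u (maxn N K)); exists (maxn N K) => // n /= Mn.
rewrite ballEmdist/= -(ltr_pM2r c1').
rewrite -(subnKC Mn); apply: le_lt_trans (tail _ _ (leq_maxl _ _)) _.
exact/hK/leq_maxr.
Qed.

Lemma duality_orbit_limit_fixed {R : realType} {X : metricType R} (S T : X -> set X)
    (phi : R -> R) (u : nat -> X) (x : X) :
  duality_phi_weak_contractions phi S T ->
  upper_semicontinuous_on [set t : R | 0 <= t] phi ->
  (forall n, S (u n.*2) (u n.*2.+1)) -> u @ \oo --> x -> T x x.
Proof.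
move=> [[CS CT] phi0 phi00 philt HST] usc Su /metricType_numDomainType.cvgrPdist_lt ux.
have [T0 clT _] := CT x.
apply: closed_dist_set0 => //; rewrite leNgt; apply/negP.
set D := dist_set x (T x) => /[dup] D0 /philt phiD.
have [e e0 he] := usc_nneg phi D ((phi D + D) / 2) usc (ltW D0) ltac:(lra).
(* With p, q within e / 2 of x, d(p, q) < e and so M(p, x) < D + e. The other bound gives D <= d(x,
   q) + d(q, T x) < (D - phi D) / 2 + (phi D + D) / 2 = D. *)
have m0 : 0 < Num.min (e / 2) ((D - phi D) / 2).
  by rewrite lt_min; apply/andP; split; lra.
have [N _ hN] := ux _ m0.
have := hN N.*2.+1; have := hN N.*2 => /=.
rewrite -addnn leqW ?leq_addr// !lt_min => /(_ isT)/andP[a1 a2] /(_ isT)/andP[b1 b2].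
rewrite addnn in a1 a2 b1 b2.
set p := u N.*2 in a1 a2 *; set q := u N.*2.+1 in b1 b2 *.
have Spq : S p q := Su N.
have := dist_set_hausdorff q _ _ (CS p) (CT x) Spq.
have DM : D <= Mmax S T p x by rewrite /Mmax !le_max lexx /= orbT.
have ME : Mmax S T p x < D + e.
  have px := metric_sym x p.
  have t1 := dist_set_le p q _ Spq.
  have t2 := metric_triangle p x q.
  have t3 := dist_set_lip p x (T x) T0.
  have t4 := dist_set_le x q _ Spq.
  by rewrite /Mmax !gt_max -!andbA -/D in t3 *; apply/and4P; split; lra.
have := he _ (le_trans (ltW D0) DM); rewrite DM ME => /(_ isT).
have := HST p x; have := dist_set_lip x q (T x) T0; rewrite -/D.
lra.
Qed.

Lemma alternating_orbit {R : realType} {X : metricType R} (S T : X -> set X)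
    (phi : R -> R) (x0 : X) :
  duality_phi_weak_contractions phi S T ->
  exists u : nat -> X, (forall n, S (u n.*2) (u n.*2.+1)) /\
    forall n, mdist (u n.+1) (u n.+2) <=
      (phi (mdist (u n) (u n.+1)) + mdist (u n) (u n.+1)) / 2.
Proof.
move=> dST; pose F (b : bool) := if b then T else S.
have [x1 Sx1] : S x0 !=set0 by case: dST => -[/(_ x0)[]].
(* The hypothesis sits under the existential so that [choice] yields a total function; [b] records
   which map produced [p.2] from [p.1]. *)
have step (b : bool) (p : X * X) : exists z, F b p.1 p.2 ->
    F (~~ b) p.2 z /\
    mdist p.2 z <= (phi (mdist p.1 p.2) + mdist p.1 p.2) / 2.
  have [h|h] := pselect (F b p.1 p.2); last by exists x0.
  have dF : duality_phi_weak_contractions phi (F b) (F (~~ b)).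
    by case: b {h} => //; exact: duality_sym.
  by have [z ? ?] := duality_step _ _ phi p.1 p.2 dF h; exists z.
have [g hg] := choice (fun bp => step bp.1 bp.2).
(* The state holds two consecutive points, since the bound on the next step involves the previous
   one; parity selects the map. *)
pose v := fix v n := if n is m.+1 then ((v m).2, g (odd m, v m)) else (x0, x1).
have Fv n : F (odd n) (v n).1 (v n).2.
  by elim: n => [|n IH] //=; exact: (hg (odd n, v n) IH).1.
exists (fun n => (v n).1); split => n; last exact: (hg (odd n, v n) (Fv n)).2.
by have := Fv n.*2; rewrite odd_double.
Qed.

Theorem theorem3p2 (R : realType) (X : completeMetricType R)
    (S T : X -> set X) (phi : R -> R)
    (hST : duality_phi_weak_contractions phi S T)
    (phi_usc : upper_semicontinuous_on [set t : R | 0 <= t] phi)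
    (phi_limsup : (limf_esup (fun t : R => (phi t / t)%:E) 0^'+ < 1)%E) :
  Fix S = Fix T /\ Fix S !=set0.
Proof.
have hTS := duality_sym _ _ _ hST.
have fixE : Fix S = Fix T.
  by apply/seteqP; split => x; [exact: duality_fix hST | exact: duality_fix hTS].
(* The orbit starts with [S], so comparing [S] at its even points with [T] at the limit puts the
   limit in [Fix T]. *)
split=> //; rewrite fixE.
have [u [Su du]] := alternating_orbit _ _ _ (point : X) hST.
have [_ _ phi00 philt _] := hST.
pose d n := mdist (u n) (u n.+1).
have d0 n : 0 <= d n := mdist_ge0 _ _.
have small := halfway_decay phi d phi00 philt phi_usc d0 du.
have [c /andP[c0 c1] [e e0 ce]] := limsup_ratio_lt1 _ phi_limsup.
have [N hN] := small e e0.
have [|||x ux] := cvg_geometric_steps u ((1 + c) / 2) N.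
- by apply/andP; split; lra.
- move=> n /hN dn; have := du n; rewrite -/(d n) -/(d n.+1).
  (* The bound by [c] covers only positive lengths; a zero step is followed by a zero step because
     phi 0 = 0. *)
  have := d0 n; rewrite le_eqVlt => /orP[/eqP <-|dn0].
    by rewrite phi00; lra.
  have := ce _ dn0 dn; lra.
- exact: small.
by exists x; exact: (duality_orbit_limit_fixed _ _ _ _ _ hST phi_usc Su ux).
Qed.
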